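(* For a fixed pair $(a,b)\in\mathbb{R}^+\times\mathbb{R}^+$ the function $L_c$ satisfies: (1) $\displaystyle\lim_{c\to-\infty}L_c(a,b)=\lim_{c\to+\infty}L_c(a,b)=\max(a,b)$; (2) $\displaystyle\lim_{c\to-1^-}L_c(a,b)=+\infty$; (3) $\displaystyle\lim_{c\to-1^+}L_c(a,b)=\frac{2ab}{a+b}=H(a,b)$.
   Context: $\mathbb{R}^+$ denotes the set of positive real numbers, and $H(a,b)=\frac{2ab}{a+b}$ is the harmonic mean. For $c\in\mathbb{R}\setminus\{-1\}$ and $a,b>0$, the function $L_c$ is defined by $$L_c(a,b)=\frac{a+b}{2}\cdot\frac{1+2c}{2(1+c)}+\frac{1}{2(1+c)}\sqrt{\left(\frac{a+b}{2}\right)^2+4c(1+c)\left(\frac{b-a}{2}\right)^2}.$$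
   Formalization: The coefficient of the square root in L_c is taken as 1/(2|1+c|) instead of 1/(2(1+c)); they agree for c > -1, but for c < -1 the printed L_c never exceeds (a+b)/2 and tends to min(a,b) as c → -∞, so claim (2) and half of (1) fail as printed. *)

(* Defs.v *)
From Stdlib Require Import Reals.
From Coquelicot Require Import Coquelicot.
Open Scope R_scope.

Definition H (a b : R) : R := 2 * a * b / (a + b).

(* With A = (a+b)/2 and D = (b-a)/2, L c a b is the larger root of
     (1+c) x^2 - (1+2c) A x + c a b = 0,
   whose discriminant is A^2 + 4c(1+c) D^2 (nonnegative for a, b > 0).
   Erratum: the source displays 2(1+c), not 2|1+c|, in front of the square
   root.  The two agree for c > -1, but for c < -1 the displayed formula gives
   the smaller root, which never exceeds A and tends to min(a,b) as c -> -oo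
   and to H a b as c -> -1^-; the limits max(a,b) and +oo asserted there are
   those of the larger root.
   The value at c = -1 is junk. *)
Definition L (c a b : R) : R :=
  (a + b) / 2 * ((1 + 2 * c) / (2 * (1 + c)))
  + 1 / (2 * Rabs (1 + c))
    * sqrt (((a + b) / 2) ^ 2 + 4 * c * (1 + c) * ((b - a) / 2) ^ 2).

(* Main.v *)
(* Put A = (a+b)/2, D = (b-a)/2 and t = 1/(1+c).  Since t^2 c (1+c) = 1 - t,
     L_c = A (1 - t/2) + sqrt (A^2 t^2 + 4 (1-t) D^2) / 2,
   which is continuous in t, with value A + |D| = max(a,b) at t = 0, and is at
   least A (1 - t/2), which blows up as t -> -oo.  For c > -1, rationalizing the
   numerator of (S - A) / (2 (1+c)), where S is the square root in L_c, gives
     L_c = A + 2 c D^2 / (S + A),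
   which is continuous at c = -1 with value A - D^2 / A = H(a,b). *)
Require Import Defs.
From Stdlib Require Import Reals Lra.
From Coquelicot Require Import Coquelicot.
Open Scope R_scope.

Definition L_inv (a b t : R) : R :=
  (a + b) / 2 * (1 - t / 2)
  + sqrt (((a + b) / 2) ^ 2 * t ^ 2 + 4 * (1 - t) * ((b - a) / 2) ^ 2) / 2.

(** The factor 1/|1+c| enters the square root as t^2. The absolute value is what makes this valid on
    both sides of -1. *)
Lemma L_eq_L_inv (a b c : R) : c <> -1 -> L c a b = L_inv a b (/ (1 + c)).
Proof.
intros Hc.
assert (Hc' : 1 + c <> 0) by lra.
unfold L, L_inv.
replace (((a + b) / 2) ^ 2 * (/ (1 + c)) ^ 2
         + 4 * (1 - / (1 + c)) * ((b - a) / 2) ^ 2)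
  with (Rsqr (/ (1 + c))
        * (((a + b) / 2) ^ 2 + 4 * c * (1 + c) * ((b - a) / 2) ^ 2))
  by (unfold Rsqr; field; exact Hc').
rewrite sqrt_mult_alt by apply Rle_0_sqr.
rewrite sqrt_Rsqr_abs, Rabs_inv.
field; split; [apply Rabs_no_R0|]; exact Hc'.
Qed.

Lemma L_inv_0 (a b : R) : L_inv a b 0 = Rmax a b.
Proof.
unfold L_inv.
replace (((a + b) / 2) ^ 2 * 0 ^ 2 + 4 * (1 - 0) * ((b - a) / 2) ^ 2)
  with (Rsqr (b - a)) by (unfold Rsqr; field).
rewrite sqrt_Rsqr_abs.
unfold Rabs, Rmax; destruct (Rcase_abs (b - a)), (Rle_dec a b); lra.
Qed.

Lemma continuous_L_inv (a b t : R) : continuous (L_inv a b) t.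
Proof.
unfold L_inv.
apply (continuous_plus (fun t => (a + b) / 2 * (1 - t / 2))).
- apply (ex_derive_continuous (V := R_NormedModule)); auto_derive; exact I.
- apply (continuous_mult (K := R_AbsRing) _ (fun _ => / 2)).
  2: apply continuous_const.
  (* Differentiability is out of reach here: for a = b the radicand vanishes at t = 0. But [sqrt] is
     continuous on all of R, being 0 on negative reals. *)
  apply continuous_comp; [|apply continuous_sqrt].
  apply (ex_derive_continuous (V := R_NormedModule)); auto_derive; exact I.
Qed.

Lemma is_lim_L_infty (a b : R) (x : Rbar) :
  x = m_infty \/ x = p_infty -> is_lim (fun c => L c a b) x (Rmax a b).
Proof.
intros Hx.
assert (Hloc : Rbar_locally' x (fun c => c <> -1)).
{ destruct Hx as [-> | ->]; exists (-1); intros c Hc; lra. }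
assert (Hinv : filterlim (fun c => / (1 + c)) (Rbar_locally' x) (locally 0)).
{ change (is_lim (fun c => / (1 + c)) x 0).
  (* [Rbar_inv] sends both infinities to 0, so one argument serves both ends. *)
  replace (Finite 0) with (Rbar_inv x) by (destruct Hx as [-> | ->]; reflexivity).
  apply is_lim_inv.
  - apply (is_lim_plus (fun _ => 1) (fun c => c) x 1 x x).
    + apply is_lim_const.
    + apply is_lim_id.
    + destruct Hx as [-> | ->]; reflexivity.
  - destruct Hx as [-> | ->]; discriminate. }
apply (filterlim_ext_loc (fun c => L_inv a b (/ (1 + c)))).
- apply filter_imp with (2 := Hloc).
  intros c Hc; symmetry; apply L_eq_L_inv, Hc.
- rewrite <- L_inv_0.
  exact (filterlim_comp _ _ _ _ _ _ _ _ Hinv (continuous_L_inv a b 0)).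
Qed.

Lemma filterlim_L_left (a b : R) :
  0 < a + b ->
  filterlim (fun c => L c a b) (at_left (-1)) (Rbar_locally p_infty).
Proof.
intros Hab.
(* Dropping the square root and the positive term A from [L_inv] leaves the minorant -A t/2. *)
apply (filterlim_ge_p_infty (fun c => - ((a + b) / 4) * / (c - -1))).
- exists posreal_one; intros c _ Hc.
  rewrite L_eq_L_inv by lra; unfold L_inv.
  replace (c - -1) with (1 + c) by ring.
  match goal with |- context [sqrt ?X] => pose proof (sqrt_pos X) end.
  lra.
- intros P [M HM].
  (* The radius is where the minorant equals |M| + 1, a bound that is positive whatever the sign of
     M. *)
  assert (HM0 : 0 < Rabs M + 1) by (pose proof (Rabs_pos M); lra).
  assert (Hd : 0 < (a + b) / 4 / (Rabs M + 1)) by (apply Rdiv_lt_0_compat; lra).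
  exists (mkposreal _ Hd); intros c Hball Hc.
  apply HM.
  assert (Hlt : -1 - c < (a + b) / 4 / (Rabs M + 1)).
  { pose proof (Rabs_def2 _ _ Hball) as Hb.
    unfold minus, plus, opp in Hb; simpl in Hb; lra. }
  apply Rle_lt_trans with (Rabs M); [apply Rle_abs|].
  replace (- ((a + b) / 4) * / (c - -1)) with ((a + b) / 4 / (-1 - c))
    by (field; split; lra).
  apply Rlt_trans with (Rabs M + 1); [lra|].
  apply Rlt_div_r in Hlt; [|lra].
  apply Rlt_div_r; [lra|].
  lra.
Qed.

Lemma L_rationalized (a b c : R) :
  0 < a -> 0 < b -> -1 < c ->
  L c a b =
  (a + b) / 2
  + 2 * c * ((b - a) / 2) ^ 2
    / (sqrt (((a + b) / 2) ^ 2 + 4 * c * (1 + c) * ((b - a) / 2) ^ 2)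
       + (a + b) / 2).
Proof.
intros ha hb hc.
unfold L; rewrite Rabs_pos_eq by lra.
set (X := ((a + b) / 2) ^ 2 + 4 * c * (1 + c) * ((b - a) / 2) ^ 2).
assert (HX : 0 <= X).
(* Complete the square in c, using A^2 - D^2 = ab. *)
{ replace X with (a * b + ((1 + 2 * c) * ((b - a) / 2)) ^ 2)
    by (unfold X; field).
  pose proof (pow2_ge_0 ((1 + 2 * c) * ((b - a) / 2))); nra. }
pose proof (sqrt_pos X) as HS.
(* This is X - A^2 = 4c(1+c) D^2, factored and divided by 2(1+c); the factor S + A then cancels. *)
assert (HD : 2 * c * ((b - a) / 2) ^ 2
             = (sqrt X - (a + b) / 2) * (sqrt X + (a + b) / 2) / (2 * (1 + c))).
{ replace ((sqrt X - (a + b) / 2) * (sqrt X + (a + b) / 2))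
    with (sqrt X * sqrt X - ((a + b) / 2) ^ 2) by ring.
  rewrite sqrt_sqrt by exact HX; unfold X; field; lra. }
rewrite HD; field; lra.
Qed.

Lemma filterlim_L_right (a b : R) :
  0 < a -> 0 < b ->
  filterlim (fun c => L c a b) (at_right (-1)) (locally (H a b)).
Proof.
intros ha hb.
set (f := fun c => (a + b) / 2
  + 2 * c * ((b - a) / 2) ^ 2
    / (sqrt (((a + b) / 2) ^ 2 + 4 * c * (1 + c) * ((b - a) / 2) ^ 2)
       + (a + b) / 2)).
assert (Hsq : ((a + b) / 2) ^ 2 + 4 * (-1) * (1 + -1) * ((b - a) / 2) ^ 2
              = Rsqr ((a + b) / 2)) by (unfold Rsqr; ring).
assert (Hf : f (-1) = H a b).
{ unfold f, H; rewrite Hsq, sqrt_Rsqr by lra; field; lra. }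
assert (Hcont : continuous f (-1)).
{ apply (ex_derive_continuous (V := R_NormedModule)).
  unfold f; auto_derive.
  change ((a + b) / 2 * ((a + b) / 2 * 1)
          + 4 * -1 * (1 + -1) * ((b - a) / 2 * ((b - a) / 2 * 1)))
    with (((a + b) / 2) ^ 2 + 4 * -1 * (1 + -1) * ((b - a) / 2) ^ 2).
  rewrite Hsq.
  (* At c = -1 the radicand is A^2 > 0 and the denominator is 2A, so [f] is differentiable there. *)
  repeat split.
  - apply Rsqr_pos_lt; lra.
  - rewrite sqrt_Rsqr; lra. }
rewrite <- Hf.
apply (filterlim_ext_loc f).
- exists posreal_one; intros c _ Hc; symmetry; apply L_rationalized; assumption.
- apply (filterlim_filter_le_1 (F := locally (-1)) (G := at_right (-1)) f).
  + apply filter_le_within.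
  + exact Hcont.
Qed.

Theorem proposition5 (a b : R) (ha : 0 < a) (hb : 0 < b) :
  (is_lim (fun c => L c a b) m_infty (Finite (Rmax a b)) /\
   is_lim (fun c => L c a b) p_infty (Finite (Rmax a b))) /\
  filterlim (fun c => L c a b) (at_left (-1)) (Rbar_locally p_infty) /\
  (filterlim (fun c => L c a b) (at_right (-1))
     (locally (2 * a * b / (a + b))) /\
   2 * a * b / (a + b) = H a b).
Proof.
split; [split|split; [|split]].
- apply is_lim_L_infty; left; reflexivity.
- apply is_lim_L_infty; right; reflexivity.
- apply filterlim_L_left; lra.
- exact (filterlim_L_right a b ha hb).
- reflexivity.
Qed.
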